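(* Let $R=\mathbb C[x_1,\ldots,x_n]$ be a polynomial ring, let $a_1,\ldots,a_n$ be positive integers, and consider the ideal $I=\overline{(x_1^{a_1},\ldots,x_n^{a_n})}$. Then $$\nu_I=\operatorname{lcm}(a_1,\ldots,a_n).$$
   Context: $\overline J$ denotes the integral closure of an ideal $J$. $\nu_I$ is the value at the unique closed point of the Behrend function of $X=\operatorname{Spec}(R/I)$. With $G=\operatorname{gr}_I(R)=\bigoplus_{j\ge0}I^j/I^{j+1}$ and $A=R/I$, Behrend's formula is $\nu_X=\sum_{\mathfrak P}(-1)^{\dim(A/\mathfrak P\cap A)}\lambda(G_{\mathfrak P})\operatorname{Eu}([\mathfrak P\cap A])$, sum over the minimal primes of $G$, with $\lambda$ length and $\operatorname{Eu}$ MacPherson's local Euler obstruction; for zero-dimensional $I$ this reads $\nu_I=\sum_{\mathfrak P}\lambda(G_{\mathfrak P})$, which may be taken as the definition of $\nu_I$. *)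

(* Defs.v *)
From HB Require Import structures.
From mathcomp Require Import all_boot all_order all_algebra.
From mathcomp Require Import boolp classical_sets reals.
From mathcomp Require Import constructive_ereal ereal esum ring.

Set Implicit Arguments.
Unset Strict Implicit.
Unset Printing Implicit Defensive.

Import Order.TTheory GRing.Theory.
Local Open Scope ring_scope.
Local Open Scope classical_set_scope.
Local Open Scope quotient_scope.

(* Ideals of a commutative ring A are sets of type set A.  The rings below
   that could a priori be zero are comPzRingTypes. *)

Section Ideals.
Variable A : comPzRingType.
Implicit Types (I J S : set A) (j : nat).

Definition is_ideal I : Prop :=
  [/\ I 0, forall x y, I x -> I y -> I (x + y) &
      forall a x, I x -> I (a * x)].

Definition is_prime I : Prop :=
  [/\ is_ideal I, ~ I 1 & forall x y, I (x * y) -> I x \/ I y].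

Definition ideal_gen S : set A := smallest is_ideal S.

(* Here I may be any set: ideal_pow I j is the j-th power of the ideal it
   generates; in particular ideal_pow I 0 is the unit ideal. *)
Definition ideal_pow I j : set A :=
  ideal_gen [set x | exists2 f : 'I_j -> A,
                     (forall k, I (f k)) & x = \prod_(k < j) f k].

(* x^m + c_1 x^(m-1) + ... + c_m = 0 with m >= 1 and c_i in J^i *)
Definition integral_closure J : set A :=
  [set x | exists (m : nat) (c : nat -> A),
    [/\ (0 < m)%N, forall i, (1 <= i <= m)%N -> ideal_pow J i (c i) &
        x ^+ m + \sum_(1 <= i < m.+1) c i * x ^+ (m - i) = 0]].

Lemma ideal_gen_is_ideal S : is_ideal (ideal_gen S).
Proof.
split=> [J [[]] //|x y Ix Iy J JS|a x Ix J JS].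
- by case: (JS) => -[_ D _] _; apply: D; [exact: Ix | exact: Iy].
- by case: (JS) => -[_ _ M] _; apply: M; exact: Ix.
Qed.

Lemma ideal_gen_sub S : S `<=` ideal_gen S.
Proof. by move=> x Sx J [_]; apply. Qed.

Lemma ideal_gen_min S J : is_ideal J -> S `<=` J -> ideal_gen S `<=` J.
Proof. by move=> JI SJ x; apply. Qed.

Lemma ideal_pow_is_ideal I j : is_ideal (ideal_pow I j).
Proof. exact: ideal_gen_is_ideal. Qed.

Lemma ideal_sum I (T : Type) (s : seq T) (F : T -> A) :
  is_ideal I -> (forall i, I (F i)) -> I (\sum_(i <- s) F i).
Proof. by move=> [I0 ID _] IF; elim/big_ind: _. Qed.

Lemma ideal_opp I x : is_ideal I -> I x -> I (- x).
Proof. by move=> [_ _ IM] Ix; rewrite -mulN1r; apply: IM. Qed.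

Lemma ideal_pow0 I : ideal_pow I 0 1.
Proof.
by apply: ideal_gen_sub; exists (fun=> 0) => [[]//|]; rewrite big_ord0.
Qed.

Lemma ideal_powM I i j x y :
  ideal_pow I i x -> ideal_pow I j y -> ideal_pow I (i + j) (x * y).
Proof.
have [P0 PD PM] := ideal_pow_is_ideal I (i + j).
move=> Ix Iy; move: x Ix; apply: ideal_gen_min.
  split=> [|u v Iu Iv|a u Iu] /=; first by rewrite mul0r.
    by rewrite mulrDl; apply: PD.
  by rewrite -mulrA; apply: PM.
move=> _ [f If ->] /=; move: y Iy; apply: ideal_gen_min.
  split=> [|u v Iu Iv|a u Iu] /=; first by rewrite mulr0.
    by rewrite mulrDr; apply: PD.
  by rewrite mulrCA; apply: PM.
move=> _ [g Ig ->] /=; apply: ideal_gen_sub.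
exists (fun k => match split k with inl a => f a | inr b => g b end).
  by move=> k; case: (split k).
rewrite big_split_ord /=; congr (_ * _); apply: eq_bigr => k _.
- case: splitP => [l /= /val_inj -> //|l /= E].
  by have := ltn_ord k; rewrite E ltnNge leq_addr.
- case: splitP => [l /= E|l /= /eqP]; last first.
    by rewrite eqn_add2l => /eqP /val_inj ->.
  by have := ltn_ord l; rewrite -E ltnNge leq_addr.
Qed.

Lemma ideal_powS I j : ideal_pow I j.+1 `<=` ideal_pow I j.
Proof.
have PI := ideal_pow_is_ideal I j; apply: ideal_gen_min => // _ [f If ->].
rewrite big_ord_recl; have [_ _ PM] := PI; apply: PM; apply: ideal_gen_sub.
by exists (fun k => f (lift ord0 k)).
Qed.

End Ideals.

(* gr_I(A), the direct sum of the I^j / I^(j+1), is the quotient of the Rees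
   algebra { sum_j f_j T^j | f_j in I^j }, as a subring of A[T], by its ideal
   { sum_j f_j T^j | f_j in I^(j+1) }. *)
Section AssociatedGraded.
Variables (A : comNzRingType) (I : set A).

Definition rees_pred : {pred {poly A}} :=
  fun p => `[< forall j, ideal_pow I j p`_j >].

Lemma reesP (p : {poly A}) :
  reflect (forall j, ideal_pow I j p`_j) (p \in rees_pred).
Proof. exact: asboolP. Qed.

Lemma rees_subring_closed : subring_closed rees_pred.
Proof.
split.
- apply/reesP=> j; rewrite coef1; case: eqP => [->|_].
    exact: ideal_pow0.
  by have [] := ideal_pow_is_ideal I j.
- move=> p q /reesP Ip /reesP Iq; apply/reesP=> j; rewrite coefB.
  have PI := ideal_pow_is_ideal I j; have [_ PD _] := PI.
  by apply: PD; [exact: Ip | apply: ideal_opp PI (Iq j)].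
- move=> p q /reesP Ip /reesP Iq; apply/reesP=> j; rewrite coefM.
  apply: (ideal_sum _ (ideal_pow_is_ideal I j)) => i.
  by have := ideal_powM (Ip i) (Iq (j - i)%N); rewrite subnKC // -ltnS.
Qed.

HB.instance Definition _ :=
  GRing.isSubringClosed.Build {poly A} rees_pred rees_subring_closed.

Record rees := Rees { rees_val :> {poly A}; _ : rees_val \in rees_pred }.

HB.instance Definition _ := [isSub for rees_val].
HB.instance Definition _ := [Choice of rees by <:].
HB.instance Definition _ := [SubChoice_isSubComNzRing of rees by <:].

Lemma rees_coef (p : rees) j : ideal_pow I j (val p)`_j.
Proof. by case: p => p /= /reesP. Qed.

Definition gr_ker : {pred rees} :=
  fun p => `[< forall j, ideal_pow I j.+1 (val p)`_j >].

Lemma gr_kerP (p : rees) :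
  reflect (forall j, ideal_pow I j.+1 (val p)`_j) (p \in gr_ker).
Proof. exact: asboolP. Qed.

Lemma gr_ker_zmod_closed : zmod_closed gr_ker.
Proof.
split.
- by apply/gr_kerP=> j; rewrite coef0; have [] := ideal_pow_is_ideal I j.+1.
- move=> p q /gr_kerP Ip /gr_kerP Iq; apply/gr_kerP=> j.
  rewrite raddfB coefB.
  have PI := ideal_pow_is_ideal I j.+1; have [_ PD _] := PI.
  by apply: PD; [exact: Ip | apply: ideal_opp PI (Iq j)].
Qed.

HB.instance Definition _ :=
  GRing.isZmodClosed.Build rees gr_ker gr_ker_zmod_closed.

Lemma gr_kerM (p q : rees) : q \in gr_ker -> p * q \in gr_ker.
Proof.
move=> /gr_kerP Iq; apply/gr_kerP=> j; rewrite rmorphM coefM.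
apply: (ideal_sum _ (ideal_pow_is_ideal I j.+1)) => i.
have := ideal_powM (@rees_coef p i) (Iq (j - i)%N).
by rewrite addnS subnKC // -ltnS.
Qed.

Definition gr : Type := Quotient.quot gr_ker.

HB.instance Definition _ := GRing.Zmodule.on gr.
HB.instance Definition _ := EqQuotient.on gr.

Definition gr_class (p : rees) : gr := \pi_gr p.

Definition gr_one : gr := gr_class 1.
Definition gr_mul (u v : gr) : gr := gr_class (repr u * repr v).

Lemma gr_ind (K : gr -> Prop) : (forall p, K (gr_class p)) -> forall x, K x.
Proof. by move=> H x; rewrite -(reprK x). Qed.

Lemma gr_eqP (p q : rees) : gr_class p = gr_class q <-> p - q \in gr_ker.
Proof. by rewrite Quotient.idealrBE; split=> [H|/eqP H]; first apply/eqP. Qed.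

Lemma gr_classD (p q : rees) : gr_class (p + q) = gr_class p + gr_class q.
Proof. exact: Quotient.pi_add. Qed.

Lemma gr_mulE (p q : rees) :
  gr_mul (gr_class p) (gr_class q) = gr_class (p * q).
Proof.
apply/gr_eqP; set p' := repr _; set q' := repr _.
have Hp : p' - p \in gr_ker by apply/gr_eqP; exact: reprK.
have Hq : q' - q \in gr_ker by apply/gr_eqP; exact: reprK.
have -> : p' * q' - p * q = p' * (q' - q) + q * (p' - p) by ring.
by apply: rpredD; apply: gr_kerM.
Qed.

Lemma gr_mulA : associative gr_mul.
Proof.
elim/gr_ind=> x; elim/gr_ind=> y; elim/gr_ind=> z.
by rewrite !gr_mulE mulrA.
Qed.

Lemma gr_mulC : commutative gr_mul.
Proof. by move=> x y; rewrite /gr_mul mulrC. Qed.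

Lemma gr_mul1 : left_id gr_one gr_mul.
Proof. by elim/gr_ind=> x; rewrite gr_mulE mul1r. Qed.

Lemma gr_mulDl : left_distributive gr_mul +%R.
Proof.
elim/gr_ind=> x; elim/gr_ind=> y; elim/gr_ind=> z.
by rewrite -gr_classD !gr_mulE mulrDl gr_classD.
Qed.

HB.instance Definition _ :=
  GRing.Zmodule_isComPzRing.Build gr gr_mulA gr_mulC gr_mul1 gr_mulDl.

End AssociatedGraded.

Section Localization.
Variable A : comPzRingType.

Record prime_ideal := PrimeIdeal {
  prime_set :> set A;
  prime_setP : is_prime prime_set }.

HB.instance Definition _ := gen_eqMixin prime_ideal.
HB.instance Definition _ := gen_choiceMixin prime_ideal.

Definition minimal_prime (P : prime_ideal) : Prop :=
  forall Q : prime_ideal, Q `<=` P -> P `<=` Q.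

Variable P : prime_ideal.

Record denom := Denom { denom_val : A; denomP : ~ prime_set P denom_val }.

HB.instance Definition _ := gen_eqMixin denom.
HB.instance Definition _ := gen_choiceMixin denom.

Lemma denom1_subproof : ~ prime_set P 1.
Proof. by have [] := prime_setP P. Qed.
Definition denom1 := Denom denom1_subproof.

Lemma denomM_subproof (s t : denom) : ~ prime_set P (denom_val s * denom_val t).
Proof. by have [_ _ PM] := prime_setP P; case/PM; exact: denomP. Qed.
Definition denomM (s t : denom) := Denom (@denomM_subproof s t).

Definition loc_equiv (x y : A * denom) : bool :=
  `[< exists u : denom,
        denom_val u * (x.1 * denom_val y.2 - y.1 * denom_val x.2) = 0 >].

Lemma loc_equivP x y :
  reflect (exists u : denom, denom_val u * (x.1 * denom_val y.2) =
                             denom_val u * (y.1 * denom_val x.2))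
          (loc_equiv x y).
Proof.
apply: (iffP (asboolP _)) => -[u Hu]; exists u.
  by apply/eqP; rewrite -subr_eq0 -mulrBr Hu.
by rewrite mulrBr Hu subrr.
Qed.

Lemma loc_equiv_refl : reflexive loc_equiv.
Proof. by move=> x; apply/loc_equivP; exists denom1. Qed.

Lemma loc_equiv_sym : symmetric loc_equiv.
Proof.
by move=> x y; apply/loc_equivP/loc_equivP => -[u Hu]; exists u; rewrite Hu.
Qed.

Lemma loc_equiv_trans : transitive loc_equiv.
Proof.
move=> [y t] [x s] [z r] /loc_equivP[u /= Hu] /loc_equivP[v /= Hv].
apply/loc_equivP; exists (denomM t (denomM u v)) => /=.
move: (denom_val s) (denom_val t) (denom_val r) Hu Hv => s' t' r' Hu Hv.
transitivity (denom_val v * r' * (denom_val u * (x * t'))); first by ring.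
rewrite Hu.
transitivity (denom_val u * s' * (denom_val v * (y * r'))); first by ring.
by rewrite Hv; ring.
Qed.

Canonical loc_equiv_rel :=
  EquivRel loc_equiv loc_equiv_refl loc_equiv_sym loc_equiv_trans.

Definition localization : Type := {eq_quot loc_equiv}.

HB.instance Definition _ : EqQuotient _ loc_equiv localization :=
  EqQuotient.on localization.
HB.instance Definition _ := Choice.on localization.

Definition loc_frac (a : A) (s : denom) : localization :=
  \pi_localization (a, s).

Definition loc_zero := loc_frac 0 denom1.
Definition loc_one := loc_frac 1 denom1.
Definition loc_opp (x : localization) :=
  loc_frac (- (repr x).1) (repr x).2.
Definition loc_add (x y : localization) :=
  loc_frac ((repr x).1 * denom_val (repr y).2 +
            (repr y).1 * denom_val (repr x).2)
           (denomM (repr x).2 (repr y).2).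
Definition loc_mul (x y : localization) :=
  loc_frac ((repr x).1 * (repr y).1) (denomM (repr x).2 (repr y).2).

Lemma loc_fracP a s b t :
  loc_frac a s = loc_frac b t <->
  exists u : denom,
    denom_val u * (a * denom_val t) = denom_val u * (b * denom_val s).
Proof.
split; first by move/eqmodP/loc_equivP.
by move=> H; apply/eqmodP/loc_equivP.
Qed.

Lemma loc_reprK x : loc_frac (repr x).1 (repr x).2 = x.
Proof. by rewrite /loc_frac -surjective_pairing reprK. Qed.

Lemma loc_ind (K : localization -> Prop) :
  (forall a s, K (loc_frac a s)) -> forall x, K x.
Proof. by move=> H x; rewrite -(loc_reprK x). Qed.

Lemma loc_oppE a s : loc_opp (loc_frac a s) = loc_frac (- a) s.
Proof.
have /loc_fracP[u Hu] := loc_reprK (loc_frac a s).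
by apply/loc_fracP; exists u; rewrite !mulNr !mulrN Hu.
Qed.

Lemma loc_addE a s b t :
  loc_add (loc_frac a s) (loc_frac b t) =
  loc_frac (a * denom_val t + b * denom_val s) (denomM s t).
Proof.
rewrite /loc_add.
have /loc_fracP := loc_reprK (loc_frac a s).
have /loc_fracP := loc_reprK (loc_frac b t).
move: (repr _) => [b' t'] /= [v Hv]; move: (repr _) => [a' s'] /= [u Hu].
apply/loc_fracP; exists (denomM u v) => /=.
move: (denom_val s) (denom_val t) (denom_val s') (denom_val t')
  (denom_val u) (denom_val v) Hu Hv => {}s {}t {}s' {}t' {}u {}v Hu Hv.
transitivity (v * t * t' * (u * (a' * s)) + u * s * s' * (v * (b' * t))).
  by ring.
by rewrite Hu Hv; ring.
Qed.

Lemma loc_mulE a s b t :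
  loc_mul (loc_frac a s) (loc_frac b t) = loc_frac (a * b) (denomM s t).
Proof.
rewrite /loc_mul.
have /loc_fracP := loc_reprK (loc_frac a s).
have /loc_fracP := loc_reprK (loc_frac b t).
move: (repr _) => [b' t'] /= [v Hv]; move: (repr _) => [a' s'] /= [u Hu].
apply/loc_fracP; exists (denomM u v) => /=.
move: (denom_val s) (denom_val t) (denom_val s') (denom_val t')
  (denom_val u) (denom_val v) Hu Hv => {}s {}t {}s' {}t' {}u {}v Hu Hv.
transitivity (u * (a' * s) * (v * (b' * t))); first by ring.
by rewrite Hu Hv; ring.
Qed.

Let loc_frac_eq a s b t :
  a * denom_val t = b * denom_val s -> loc_frac a s = loc_frac b t.
Proof. by move=> H; apply/loc_fracP; exists denom1; rewrite H. Qed.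

Lemma loc_addA : associative loc_add.
Proof.
elim/loc_ind=> a s; elim/loc_ind=> b t; elim/loc_ind=> c r.
rewrite !loc_addE; apply: loc_frac_eq => /=; ring.
Qed.

Lemma loc_addC : commutative loc_add.
Proof.
elim/loc_ind=> a s; elim/loc_ind=> b t; rewrite !loc_addE.
by apply: loc_frac_eq => /=; ring.
Qed.

Lemma loc_add0 : left_id loc_zero loc_add.
Proof.
elim/loc_ind=> a s; rewrite loc_addE; apply: loc_frac_eq => /=; ring.
Qed.

Lemma loc_addN : left_inverse loc_zero loc_opp loc_add.
Proof.
elim/loc_ind=> a s; rewrite loc_oppE loc_addE; apply: loc_frac_eq => /=; ring.
Qed.

HB.instance Definition _ :=
  GRing.isZmodule.Build localization loc_addA loc_addC loc_add0 loc_addN.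

Lemma loc_mulA : associative loc_mul.
Proof.
elim/loc_ind=> a s; elim/loc_ind=> b t; elim/loc_ind=> c r.
by rewrite !loc_mulE; apply: loc_frac_eq => /=; ring.
Qed.

Lemma loc_mulC : commutative loc_mul.
Proof.
elim/loc_ind=> a s; elim/loc_ind=> b t; rewrite !loc_mulE.
by apply: loc_frac_eq => /=; ring.
Qed.

Lemma loc_mul1 : left_id loc_one loc_mul.
Proof.
elim/loc_ind=> a s; rewrite loc_mulE; apply: loc_frac_eq => /=; ring.
Qed.

Lemma loc_mulDl : left_distributive loc_mul loc_add.
Proof.
elim/loc_ind=> a s; elim/loc_ind=> b t; elim/loc_ind=> c r.
rewrite !(loc_addE, loc_mulE); apply: loc_frac_eq => /=; ring.
Qed.

HB.instance Definition _ :=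
  GRing.Zmodule_isComPzRing.Build localization
    loc_mulA loc_mulC loc_mul1 loc_mulDl.

End Localization.

Section Length.
Variable R : realType.
Local Open Scope ereal_scope.

(* The length of A as a module over itself, possibly +oo: the supremum of the
   lengths k of the chains N_0 < N_1 < ... < N_k of ideals of A. *)
Definition ring_length (A : comPzRingType) : \bar R :=
  ereal_sup [set k%:R%:E | k in [set k : nat |
    exists N : nat -> set A,
      (forall i, (i <= k)%N -> is_ideal (N i)) /\
      (forall i, (i < k)%N -> N i `<` N i.+1)]].

(* Behrend's formula in the case where A / I is zero-dimensional, in which
   all the signs and local Euler obstructions are 1. *)
Definition nu (A : comNzRingType) (I : set A) : \bar R :=
  \esum_(P in [set P : prime_ideal (gr I) | minimal_prime P])
    ring_length (localization P).

End Length.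

(* Main.v *)
Require Import Defs.
From HB Require Import structures.
From mathcomp Require Import all_boot all_order all_algebra.
From mathcomp Require Import complex classical_sets reals boolp ring zify.
From mathcomp Require constructive_ereal ereal esum.

(** Write [L = lcm (a i)] and give [x_i] the weight [L / a i]; let [wt u] be the
    weight of the exponent [u].  The integral closure [I] is spanned by the
    monomials of weight at least [L], and [I^d] by the monomials whose exponent
    is a sum of [d] exponents of weight at least [L] and of any further exponent
    ([ideal_pow_closure]).  On the Rees algebra, a subring of [S[T]] with
    [S = K[x_1, ..., x_n]], the function sending [x^u T^d] to [wt u - d L]
    extends to a valuation [V >= 0].  The kernel of the projection to
    [G = gr_I(S)] lies in [V >= L] and contains all elements with
    [V >= (n + 1) L] ([wt_power_exp]).  So the elements with [V > 0] form a
    prime ideal of [G] all of whose elements are nilpotent; it is the only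
    minimal prime ([pos_prime_min]), and it remains to see that the local ring
    of [G] at this prime has length [L].

    Let [D] be the localization, at [V > 0], of the extended Rees algebra, in
    which [T^-1] is adjoined; the local ring is [D / T^-1 D].  The lattice points
    of the facet [wt = L] generate the group of all integral [(u, d)] with
    [wt u = d L] ([face_generates]), and their monomials are units of [D].
    Hence [D] contains, up to units, exactly one monomial of each value in the
    numerical semigroup of the values of [V] on monomials ([value]), and [T^-1]
    has value [L].  The values that survive modulo [T^-1] are those [k] for which
    [k - L] is not a value: the Apery set of the semigroup, with one element in
    each residue class modulo [L] ([apery]).  The filtration of the local ring by
    the values of [V] jumps exactly at these [L] values ([level_flat],
    [level_jump]) and each jump is one-dimensional over the residue field
    ([level_simple]); so the length is [L] ([ring_length_filtration]).

    The values of [V] need not include all of [0, ..., L - 1]: for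
    [a = (2, 3, 5, 7)] no monomial of the Rees algebra has value [1].  This is
    why the Apery set appears instead of an interval. *)

Set Implicit Arguments.
Unset Strict Implicit.
Unset Printing Implicit Defensive.

Import GRing.Theory.
Local Open Scope ring_scope.
Local Open Scope classical_set_scope.

(** * Length from a filtration *)

Section LengthFromFiltration.
Import constructive_ereal ereal.
Variables (A : comPzRingType) (l B : nat) (F : nat -> set A) (mu : 'I_l -> nat).
Hypothesis F_ideal : forall k, is_ideal (F k).
Hypothesis F_top : F 0 = setT.
Hypothesis F_bot : F B `<=` [set 0].
Hypothesis F_dec : forall k, F k.+1 `<=` F k.
Hypothesis mu_inj : injective mu.
Hypothesis F_flat : forall k, (forall r, mu r <> k) -> F k `<=` F k.+1.
Hypothesis F_jump : forall r, exists2 x, F (mu r) x & ~ F (mu r).+1 x.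
Hypothesis F_simple : forall r x y, F (mu r) x -> F (mu r) y ->
  ~ F (mu r).+1 y -> exists c, F (mu r).+1 (x - c * y).

Let F_anti j k : (j <= k)%N -> F k `<=` F j.
Proof.
move=> /subnKC <-; elim: (k - j)%N => [|m IH]; first by rewrite addn0.
by rewrite addnS => x /F_dec/IH.
Qed.

Let jumps (N : set A) : {set 'I_l} :=
  [set r | `[< exists x, [/\ N x, F (mu r) x & ~ F (mu r).+1 x] >]].

Let jumpsP N r :
  reflect (exists x, [/\ N x, F (mu r) x & ~ F (mu r).+1 x]) (r \in jumps N).
Proof. by rewrite finset.in_set; exact: asboolP. Qed.

(** Nested ideals with the same jumps are equal: an element of the larger one
    can be moved down the filtration by subtracting elements of the smaller. *)
Let jumps_proper (N N' : set A) : is_ideal N -> is_ideal N' -> N `<` N' ->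
  jumps N \proper jumps N'.
Proof.
move=> [N0 ND NM] [_ N'D N'M] [NN' nN'N]; rewrite properE; apply/andP; split.
  apply/fintype.subsetP => r /jumpsP[x [Nx x1 x2]].
  by apply/jumpsP; exists x; split=> //; apply: NN'.
apply/negP => /fintype.subsetP jj; apply: nN'N => x N'x.
suff H j y : N' y -> F (B - j) y -> N y by apply: (H B); rewrite // subnn F_top.
elim: j y => [|j IH] y N'y; first by rewrite subn0 => /F_bot ->.
have [lt_jB|/eqP le_Bj] := ltnP j B; last first.
  by have -> : (B - j.+1 = B - j)%N by [lia]; apply: IH.
have kE : (B - j = (B - j.+1).+1)%N by lia.
move: (B - j.+1)%N kE => k kE; rewrite kE in IH => Fy.
have [/IH//|nFy] := pselect (F k.+1 y); first exact.
have [[r rk]|nr] := pselect (exists r, mu r = k); last first.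
  by apply: IH => //; apply: F_flat Fy => r rk; apply: nr; exists r.
have /jj : r \in jumps N' by apply/jumpsP; exists y; rewrite rk; split.
move=> /jumpsP[z [Nz Fz nFz]].
rewrite -rk in Fy; have [c Fyz] := F_simple Fy Fz nFz.
rewrite -[y](subrK (c * z)); apply: ND; last exact: NM.
by apply: IH; [apply: N'D; rewrite // -mulNr; apply: N'M; apply: NN'|rewrite -rk].
Qed.

(** The jumps of an ideal determine its position in a chain, which bounds the
    length of a chain by [l]; the filtration itself, read at the jumps, is a
    chain of length [l]. *)
Lemma ring_length_filtration (R : realType) :
  ring_length R A = EFin l%:R.
Proof.
apply: Order.POrderTheory.le_anti; apply/andP; split.
  apply: ge_ereal_sup => _ [k [N [N_ideal N_chain]] <-].
  rewrite lee_fin Num.Theory.ler_nat.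
  suff H i : (i <= k)%N -> (i <= #|jumps (N i)|)%N.
    by apply: leq_trans (H k (leqnn k)) _; rewrite -[X in (_ <= X)%N]card_ord max_card.
  elim: i => // i IH lt_ik; apply: leq_ltn_trans (IH (ltnW lt_ik)) _.
  apply: proper_card; apply: jumps_proper; last exact: N_chain.
    by apply: N_ideal; apply: ltnW.
  exact: N_ideal.
apply: ereal_sup_ubound; exists l => //.
pose s := sort leq [seq mu r | r <- enum 'I_l].
have s_size : size s = l by rewrite size_sort size_map size_enum_ord.
have s_sorted : sorted ltn s.
  rewrite ltn_sorted_uniq_leq sort_uniq map_inj_uniq // enum_uniq.
  exact/sort_sorted/leq_total.
have mu_lt r : (mu r < B)%N.
  rewrite ltnNge; apply/negP => le_B; have [x Fx []] := F_jump r.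
  by have [F0 _ _] := F_ideal (mu r).+1; rewrite (F_bot (F_anti le_B Fx)).
(* For [i = 0] the default value [B] of [nth] gives the zero ideal. *)
exists (fun i => F (nth B s (l - i)%N)); split=> // i lt_il.
have [r rE] : exists r, mu r = nth B s (l - i.+1)%N.
  have : nth B s (l - i.+1)%N \in s by apply: mem_nth; rewrite s_size; lia.
  by rewrite mem_sort => /mapP[r _ ->]; exists r.
have lt_r : (mu r < nth B s (l - i))%N.
  case: i lt_il rE => [|i] lt_il rE; first by rewrite subn0 nth_default ?s_size.
  rewrite rE; apply: (sorted_ltn_nth ltn_trans) => //; rewrite ?inE ?s_size; lia.
rewrite -rE; split; first by apply: F_anti; apply: ltnW.
by have [x Fx nFx] := F_jump r => /(_ x Fx) /(F_anti lt_r).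
Qed.

End LengthFromFiltration.

Section UniqueMinimalPrime.
Import constructive_ereal ereal esum.

Lemma prime_set_inj (A : comPzRingType) (P Q : prime_ideal A) :
  P `<=>` Q -> P = Q.
Proof.
case: P Q => P HP [Q HQ] /= /seteqP PQ; subst Q.
by congr PrimeIdeal; exact: Prop_irrelevance.
Qed.

Lemma ring_length_ge0 (R : realType) (A : comPzRingType) :
  (0 <= ring_length R A)%E.
Proof.
apply: ereal_sup_ubound; exists 0%N => //; exists (fun=> setT).
by split=> // i _; split.
Qed.

Lemma nu_unique_minimal (R : realType) (A : comNzRingType) (I : set A)
    (P : prime_ideal (gr I)) :
  (forall Q : prime_ideal (gr I), P `<=` Q) ->
  nu R I = ring_length R (localization P).
Proof.
move=> P_min; rewrite /nu.
have -> : [set Q : prime_ideal (gr I) | minimal_prime Q] = [set P].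
  apply/seteqP; split=> [Q Q_min|_ ->] /=; last by move=> Q _; apply: P_min.
  by apply: prime_set_inj; split; [apply: Q_min|]; apply: P_min.
by rewrite esum_set1 //; apply: ring_length_ge0.
Qed.

End UniqueMinimalPrime.

From mathcomp Require Import mpoly.

(** * Orders of polynomials with weighted variables *)

Section WeightOrder.
Variables (K : idomainType) (n : nat) (w : 'I_n -> nat).
Implicit Types (f g : {mpoly K[n]}) (u : 'X_{1..n}).

Definition wt u : nat := \sum_(i < n) w i * u i.

Lemma wtD u u' : wt (u + u')%MM = (wt u + wt u')%N.
Proof.
by rewrite /wt -big_split; apply: eq_bigr => i _; rewrite mnmDE mulnDr.
Qed.

Lemma wt0 : wt 0%MM = 0%N.
Proof. by apply: big1 => i _; rewrite mnm0E muln0. Qed.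

Lemma wtMn u k : wt (u *+ k)%MM = (wt u * k)%N.
Proof.
by rewrite /wt big_distrl; apply: eq_bigr => i _; rewrite /= mulmnE mulnA.
Qed.

Lemma wtU i : wt U_(i)%MM = w i.
Proof.
rewrite /wt (bigD1 i) //= mnm1E eqxx muln1 big1 ?addn0 // => j ne_ji.
by rewrite mnm1E eq_sym (negbTE ne_ji) muln0.
Qed.

(** The substitution of [x_i Z^(w i)] for [x_i]. *)
Definition wexp : {mpoly K[n]} -> {poly {mpoly K[n]}} :=
  mmap (polyC \o @mpolyC n K) (fun i => 'X_i *: 'X^(w i)).

HB.instance Definition _ := GRing.RMorphism.on wexp.

(** Opaque, so that unification never evaluates polynomials. *)
Fact wpart_subproof : {F : nat -> {mpoly K[n]} -> {mpoly K[n]} |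
  F = fun k f => (wexp f)`_k}.
Proof. by exists (fun k f => (wexp f)`_k). Qed.

Definition wpart := sval wpart_subproof.

Lemma wpart_def k f : wpart k f = (wexp f)`_k.
Proof. by rewrite /wpart; case: wpart_subproof => /= _ ->. Qed.

Lemma wexpX u : wexp 'X_[u] = 'X_[u] *: 'X^(wt u).
Proof.
rewrite /wexp mmapX /mmap1 mpolyXE_id /wt -prodrXr -scaler_prod.
by apply: eq_bigr => i _; rewrite exprZn -exprM.
Qed.

Lemma wexpZ c f : wexp (c *: f) = (c%:MP)%:P * wexp f.
Proof. exact: mmapZ. Qed.

Lemma wpartE k f :
  wpart k f = \sum_(u <- msupp f | wt u == k) f@_u *: 'X_[u].
Proof.
rewrite !wpart_def {1}[f]mpolyE rmorph_sum coef_sum [RHS]big_mkcond /=.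
apply: eq_bigr => u _; rewrite wexpZ wexpX.
rewrite coefCM coefZ coefXn eq_sym; case: eqP => _; last by rewrite !mulr0.
by rewrite mulr1 mul_mpolyC.
Qed.

Lemma mcoeff_wpart k f u : (wpart k f)@_u = f@_u *+ (wt u == k).
Proof.
rewrite wpartE linear_sum /=.
under eq_bigr do rewrite mcoeffZ mcoeffX.
have [u_f|u_f] := boolP (u \in msupp f); last first.
  rewrite (memN_msupp_eq0 u_f) mul0rn big_seq_cond big1 // => v /andP[v_f _].
  by case: eqP => [vu|_]; rewrite ?mulr0 //; rewrite vu (negbTE u_f) in v_f.
rewrite big_mkcond (bigD1_seq u) ?msupp_uniq //= eqxx big1 => [|v /negbTE ne_vu].
  by rewrite addr0 mulr1 -mulrb.
by rewrite ne_vu mulr0 if_same.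
Qed.

(** The weighted order of [f] is at least [k]. *)
Definition wge k f : Prop := forall i, (i < k)%N -> wpart i f = 0.

Lemma wgeP k f : wge k f <-> {in msupp f, forall u, (k <= wt u)%N}.
Proof.
split=> [f_k u|f_k i lt_ik].
  apply: contraTT; rewrite -ltnNge => /f_k/(congr1 (mcoeff u)).
  by rewrite mcoeff_wpart eqxx mcoeff0 mcoeff_msupp negbK => /eqP.
apply/mpolyP => u; rewrite mcoeff_wpart mcoeff0.
have [/f_k|/memN_msupp_eq0->] := boolP (u \in msupp f); last by rewrite mul0rn.
by case: eqP => // ->; rewrite leqNgt lt_ik.
Qed.

Lemma wgeX u k : (k <= wt u)%N -> wge k 'X_[u].
Proof. by move=> le_k; apply/wgeP => v; rewrite msuppX inE => /eqP->. Qed.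

Lemma wpartX u : wpart (wt u) 'X_[u] = 'X_[u].
Proof. by rewrite !wpart_def wexpX coefZ coefXn eqxx mulr1. Qed.

Lemma wge0 k : wge k 0.
Proof. by move=> i _; rewrite !wpart_def rmorph0 coef0. Qed.

Lemma wpartD k f g : wpart k (f + g) = wpart k f + wpart k g.
Proof. by rewrite !wpart_def rmorphD coefD. Qed.

Lemma wgeD k f g : wge k f -> wge k g -> wge k (f + g).
Proof. by move=> f_k g_k i ik; rewrite wpartD f_k ?g_k ?addr0. Qed.

Lemma wgeW k l f : (l <= k)%N -> wge k f -> wge l f.
Proof. by move=> le_lk f_k i lt_il; apply: f_k; apply: leq_trans le_lk. Qed.

Lemma wgeS k f : wge k f -> wpart k f = 0 -> wge k.+1 f.
Proof. by move=> f_k fk0 i; rewrite ltnS leq_eqVlt => /orP[/eqP->|/f_k]. Qed.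

Lemma wpartM_conv k f g :
  wpart k (f * g) = \sum_(i < k.+1) wpart i f * wpart (k - i) g.
Proof.
rewrite wpart_def rmorphM coefM.
by apply: eq_bigr => i _; rewrite !wpart_def.
Qed.

(** In the convolution computing the part of weight [k + l] of a product, every
    term but one has a factor of too small a weight. *)
Lemma wpartM k l f g : wge k f -> wge l g ->
  wpart (k + l) (f * g) = wpart k f * wpart l g.
Proof.
move=> f_k g_l; rewrite wpartM_conv.
have lt_k : (k < (k + l).+1)%N by rewrite ltnS leq_addr.
rewrite (bigD1 (Ordinal lt_k)) //= addKn big1 ?addr0 // => -[i lt_i] /= ne_ik.
have {}ne_ik : (i != k)%N := ne_ik.
move: ne_ik; rewrite neq_ltn => /orP[/f_k fi|lt_ki]; first by rewrite fi mul0r.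
by rewrite g_l ?mulr0 //; lia.
Qed.

Lemma wgeM k l f g : wge k f -> wge l g -> wge (k + l) (f * g).
Proof.
move=> f_k g_l i lt_i; rewrite wpartM_conv big1 // => -[j lt_j] _ /=.
have [/f_k fj|le_kj] := ltnP j k; first by rewrite fj mul0r.
by rewrite g_l ?mulr0 //; lia.
Qed.

Lemma wgeXn k m f : wge k f -> wge (k * m) (f ^+ m).
Proof.
move=> f_k; elim: m => [|m IHm]; first by rewrite muln0.
by rewrite exprS mulnS; apply: wgeM.
Qed.

Lemma wpart_exp k m f : wge k f -> wpart (k * m) (f ^+ m) = wpart k f ^+ m.
Proof.
move=> f_k; elim: m => [|m IHm].
  by rewrite muln0 !expr0 -mpolyX0 -[X in wpart X]wt0 wpartX.
by rewrite !exprS mulnS wpartM ?IHm //; apply: wgeXn.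
Qed.

Lemma wge_sum k (I : eqType) (r : seq I) (F : I -> {mpoly K[n]}) :
  {in r, forall i, wge k (F i)} -> wge k (\sum_(i <- r) F i).
Proof.
elim: r => [|i r IHr] F_k; first by rewrite big_nil; apply: wge0.
rewrite big_cons; apply: wgeD; first by apply: F_k; rewrite mem_head.
by apply: IHr => j j_r; apply: F_k; rewrite inE j_r orbT.
Qed.

Lemma wpart_sum k (I : Type) (r : seq I) (F : I -> {mpoly K[n]}) :
  wpart k (\sum_(i <- r) F i) = \sum_(i <- r) wpart k (F i).
Proof.
elim: r => [|i r IHr]; last by rewrite !big_cons wpartD IHr.
by rewrite !big_nil (@wge0 k.+1).
Qed.

Lemma wge_wpart k f : wge k (wpart k f).
Proof.
apply/wgeP => u; rewrite mcoeff_msupp mcoeff_wpart.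
by case: (wt u =P k) => [->|_] //; rewrite eqxx.
Qed.

Lemma wpart_id k f : wpart k (wpart k f) = wpart k f.
Proof.
apply/mpolyP => u; rewrite (mcoeff_wpart k (wpart k f)) (mcoeff_wpart k f).
by case: (wt u == k).
Qed.

Lemma wge_exact m f : ~ wge m f ->
  exists k, [/\ (k < m)%N, wge k f & wpart k f != 0].
Proof.
elim: m => [|m IHm] f_m; first by case: f_m.
have [f_m'|/IHm[k [lt_km f_k fk0]]] := pselect (wge m f).
  exists m; split=> //; apply/eqP => /(wgeS f_m'); exact: f_m.
by exists k; split=> //; apply: ltnW.
Qed.

End WeightOrder.

(** * Weights from a least common multiple *)

Section LcmWeights.
Variables (n : nat) (a : 'I_n -> nat).
Hypothesis a_gt0 : forall i, (0 < a i)%N.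

Definition lcm_exp : nat := \big[lcmn/1%N]_(i < n) a i.

Definition lcm_wt (i : 'I_n) : nat := lcm_exp %/ a i.

Local Notation L := lcm_exp.
Local Notation w := lcm_wt.

Lemma dvdn_lcm_exp i : (a i %| L)%N.
Proof. by have /dvdn_biglcmP := dvdnn L; apply. Qed.

Lemma lcm_exp_gt0 : (0 < L)%N.
Proof.
rewrite /lcm_exp; elim/big_ind: _ => // x y x0 y0.
by rewrite lcmn_gt0 x0.
Qed.

Lemma lcm_wtK i : (w i * a i)%N = L.
Proof. by rewrite divnK // dvdn_lcm_exp. Qed.

(** If [g] divides [L] and every [L / a i], then every [a i] divides [L / g],
    which is therefore a multiple of [L]. *)
Lemma lcm_wt_coprime : gcdn (\big[gcdn/0%N]_(i < n) w i) L = 1%N.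
Proof.
set g := gcdn _ _.
have /dvdnP[h Lh] : (g %| L)%N by apply: dvdn_gcdr.
have /dvdnP[c hc] : (L %| h)%N.
  apply/dvdn_biglcmP => i _.
  have /dvdnP[c wc] : (g %| w i)%N.
    by apply: dvdn_trans (dvdn_gcdl _ _) _; rewrite (bigD1 i) //= dvdn_gcdl.
  apply/dvdnP; exists c; apply/eqP; rewrite -(eqn_pmul2r (m := g)).
    by rewrite -Lh -(lcm_wtK i) wc; apply/eqP; ring.
  by rewrite gcdn_gt0 lcm_exp_gt0 orbT.
have : (L * (c * g) == L * 1)%N by rewrite muln1 mulnA [(L * c)%N]mulnC -hc -Lh.
by rewrite eqn_pmul2l ?lcm_exp_gt0 // muln_eq1 => /andP[_ /eqP].
Qed.

(** Bezout's identity with natural coefficients; for [n = 0] it is [1 = L]. *)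
Lemma lcm_wt_bezout : exists (c : 'X_{1..n}) (q : nat), (wt w c + 1 = q * L)%N.
Proof.
pose span (g : nat) := exists b : 'I_n -> int, \sum_i b i * (w i)%:Z = g%:Z.
have [b hb] : span (\big[gcdn/0%N]_(i < n) w i).
  apply: big_ind => [|x y [b hb] [c hc]|i _].
  - by exists (fun=> 0); rewrite big1 // => i _; rewrite mul0r.
  - have [s [t hst]] := Bezoutz x%:Z y%:Z.
    exists (fun i => s * b i + t * c i).
    under eq_bigr do rewrite mulrDl -!mulrA.
    by rewrite big_split /= -!mulr_sumr hb hc hst.
  - exists (fun j => (j == i)%:Z); rewrite (bigD1 i) //= eqxx mul1r.
    by rewrite big1 ?addr0 // => j /negbTE->; rewrite mul0r.
have [s [t hst]] := Bezoutz (\big[gcdn/0%N]_(i < n) w i)%:Z L%:Z.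
have {}hst : s * (\big[gcdn/0%N]_(i < n) w i)%:Z + t * L%:Z = 1.
  by rewrite hst /gcdz !absz_nat lcm_wt_coprime.
(* Reducing the coefficients modulo [L] makes them natural numbers. *)
pose c i : int := (- (s * b i) %% L%:Z)%Z.
have c_ge0 i : (0 <= c i)%R by rewrite modz_ge0 // eqz_nat -lt0n lcm_exp_gt0.
exists [multinom `|c i|%N | i < n].
suff /dvdnP : (L %| wt w [multinom `|c i|%N | i < n] + 1)%N by [].
suff : (L%:Z %| (wt w [multinom `|c i|%N | i < n] + 1)%N%:Z)%Z by [].
apply/dvdzP; exists (t - \sum_i (w i)%:Z * (- (s * b i) %/ L%:Z)%Z).
have -> : (wt w [multinom `|c i|%N | i < n] + 1)%N%:Z =
          \sum_i (w i)%:Z * c i + 1.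
  rewrite PoszD /wt (big_morph Posz PoszD (erefl _)); congr (_ + _).
  by apply: eq_bigr => i _; rewrite PoszM mnmE gez0_abs.
rewrite -[X in _ + X = _]hst -hb mulrBl mulr_sumr mulr_suml addrA -big_split.
rewrite /= [RHS]addrC -sumrN; congr (_ + _); apply: eq_bigr => i _.
by have := divz_eq (- (s * b i)) L%:Z; rewrite -/(c i); lia.
Qed.

Lemma lcm_wt_oppk k : exists (c : 'X_{1..n}) (q : nat), (wt w c + k = q * L)%N.
Proof.
have [c [q cq]] := lcm_wt_bezout; exists (c *+ k)%MM, (q * k)%N.
by rewrite wtMn mulnAC -cq mulnDl mul1n.
Qed.

Lemma lcm_wt_surj k : (k < L)%N ->
  exists (u : 'X_{1..n}) (d : nat), (wt w u = d * L + k)%N.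
Proof.
move=> lt_kL; have [c [[|q] cq]] := lcm_wt_oppk (L - k); first by lia.
by exists c, q; move: cq; rewrite mulSn; lia.
Qed.

(** An abelian group with elements [e i] and [t], in which [a i] times [e i] is
    [- t] and [e i], [e k] satisfy the relation coming from the lattice points of
    the edge that joins the multiples [a i] and [a k] of the [i]-th and [k]-th
    unit vectors, does not see more than the weight.  As [lcm (a i) (a k)]
    divides [L], the edge relation can be scaled to
    [w k * e i = w i * e k]; Bezout's identity for the weights then writes every
    [e k] as [w k] times one element. *)
Lemma edge_relations_ker (V : zmodType) (e : 'I_n -> V) (t : V) :
  (forall i, e i *+ a i = - t) ->
  (forall i k, e i *+ (a i %/ gcdn (a i) (a k)) =
               e k *+ (a k %/ gcdn (a i) (a k))) ->
  forall u d u' d', (wt w u + d' * L = wt w u' + d * L)%N ->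
  \sum_i e i *+ u i + t *+ d = \sum_i e i *+ u' i + t *+ d'.
Proof.
move=> ea eg.
have wswap i k : e i *+ w k = e k *+ w i.
  set g := gcdn (a i) (a k).
  have g0 : (0 < g)%N by rewrite gcdn_gt0 a_gt0.
  have aig : (a i %/ g * g = a i)%N by rewrite divnK ?dvdn_gcdl.
  have akg : (a k %/ g * g = a k)%N by rewrite divnK ?dvdn_gcdr.
  have /dvdnP[c Lc] : (lcmn (a i) (a k) %| L)%N.
    by rewrite dvdn_lcm !dvdn_lcm_exp.
  have lcmE : lcmn (a i) (a k) = (a i %/ g * (a k %/ g) * g)%N.
    by apply/eqP; rewrite -(eqn_pmul2r g0) muln_lcm_gcd; apply/eqP; lia.
  have wk : w k = (a i %/ g * c)%N.
    apply/eqP; rewrite -(eqn_pmul2r (a_gt0 k)) lcm_wtK Lc lcmE -{2}akg.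
    by apply/eqP; ring.
  have wi : w i = (a k %/ g * c)%N.
    apply/eqP; rewrite -(eqn_pmul2r (a_gt0 i)) lcm_wtK Lc lcmE -{2}aig.
    by apply/eqP; ring.
  by rewrite wk wi !mulrnA eg.
have [c [q cq]] := lcm_wt_bezout.
pose z := - (t *+ q + \sum_i e i *+ c i).
have ez k : e k = z *+ w k.
  have qe : e k *+ (q * L) = - t *+ q *+ w k.
    by rewrite -(ea k) -(lcm_wtK k) -!mulrnA; congr (_ *+ _); ring.
  have ce : (\sum_i e i *+ c i) *+ w k = e k *+ wt w c.
    rewrite -sumrMnl /wt -sumrMnr; apply: eq_bigr => i _.
    by rewrite mulrnAC wswap mulrnA.
  by rewrite mulNrn mulrnDl opprD -!mulNrn -qe mulNrn ce -cq mulrnDr addrC addKr.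
have tz : t = - (z *+ L).
  have ce : (\sum_i e i *+ c i) *+ L = - t *+ wt w c.
    rewrite -sumrMnl /wt -sumrMnr; apply: eq_bigr => i _.
    by rewrite -(ea i) -!mulrnA -(lcm_wtK i); congr (_ *+ _); ring.
  rewrite mulNrn opprK mulrnDl ce mulNrn -mulrnA -cq mulrnDr.
  by rewrite [X in X - _]addrC addrK.
clearbody z; have sumE (u : 'X_{1..n}) : \sum_i e i *+ u i = z *+ wt w u.
  by under eq_bigr do rewrite ez -mulrnA; rewrite sumrMnr.
move=> u d u' d' uu'; rewrite !sumE tz !mulNrn -!mulrnA !(mulnC L).
by apply/eqP; rewrite subr_eq addrAC eq_sym subr_eq -!mulrnDr uu'.
Qed.

End LcmWeights.

(** * The facet of the Newton polyhedron *)

Section Face.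
Variables (n : nat) (a : 'I_n -> nat).
Hypothesis a_gt0 : forall i, (0 < a i)%N.

Local Notation L := (lcm_exp a).
Local Notation wt := (wt (lcm_wt a)).
Local Notation exponent := ('rV[int]_n * int)%type.

(** The monomial [x^b T^e] of such an exponent has order [0] in the Rees algebra,
    so it becomes a unit in the local ring. *)
Inductive face : 'X_{1..n} -> nat -> Prop :=
| face_nil : face 0%MM 0
| face_cons v b e of wt v = L & face b e : face (v + b)%MM e.+1.

Lemma wt_face b e : face b e -> wt b = (e * L)%N.
Proof.
by elim=> [|v {}b {}e v_L _ IH]; rewrite ?wt0 ?mul0n // wtD v_L IH mulSn.
Qed.

Lemma faceD b e b' e' : face b e -> face b' e' -> face (b + b')%MM (e + e').
Proof.
elim=> [|v {}b {}e v_L _ IH] f'; first by rewrite add0m add0n.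
by rewrite -addmA addSn; apply: face_cons => //; apply: IH.
Qed.

Lemma face1 v : wt v = L -> face v 1.
Proof. by move=> v_L; rewrite -[v]addm0; apply: face_cons => //; apply: face_nil. Qed.

Definition emb (u : 'X_{1..n}) (d : nat) : exponent := (\row_i (u i)%:Z, d%:Z).

Lemma embD u d u' d' : emb (u + u')%MM (d + d') = emb u d + emb u' d'.
Proof.
by congr (_, _) => /=; apply/rowP => i; rewrite !mxE mnmDE PoszD.
Qed.

Lemma emb_inj u d u' d' : emb u d = emb u' d' -> u = u' /\ d = d'.
Proof.
case=> /rowP uu' ->; split=> //; apply/mnmP => i.
by have := uu' i; rewrite !mxE => -[].
Qed.

Definition face_group : {pred exponent} := fun z =>
  `[< exists b e b' e', [/\ face b e, face b' e' & z = emb b e - emb b' e'] >].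

Lemma face_groupP z :
  reflect (exists b e b' e',
             [/\ face b e, face b' e' & z = emb b e - emb b' e'])
          (z \in face_group).
Proof. exact: asboolP. Qed.

Lemma face_group_zmod_closed : zmod_closed face_group.
Proof.
split=> [|_ _ /face_groupP[b [e [b' [e' [f f' ->]]]]]
               /face_groupP[c [h [c' [h' [g g' ->]]]]]].
  apply/face_groupP; exists 0%MM, 0%N, 0%MM, 0%N.
  by split; [exact: face_nil | exact: face_nil | rewrite subrr].
apply/face_groupP; exists (b + c')%MM, (e + h')%N, (b' + c)%MM, (e' + h)%N.
split; [exact: faceD | exact: faceD |].
by rewrite !embD opprB opprD addrACA.
Qed.

HB.instance Definition _ :=
  GRing.isZmodClosed.Build exponent face_group face_group_zmod_closed.

(** The quotient by the face group, known only by its addition and by the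
    equality of classes. *)
Lemma face_quotient : exists (V : zmodType) (c : 'X_{1..n} -> nat -> V),
  (forall u d u' d', c (u + u')%MM (d + d')%N = c u d + c u' d') /\
  (forall u d u' d', c u d = c u' d' <->
     exists b e b' e', [/\ face b e, face b' e',
                           (u + b = u' + b')%MM & (d + e = d' + e')%N]).
Proof.
pose Q := @Quotient.quot exponent face_group.
exists Q, (fun u d => (\pi_Q (emb u d))%qT).
split=> [u d u' d'|u d u' d']; first by rewrite embD; exact: Quotient.pi_add.
have -> : ((\pi_Q (emb u d))%qT = (\pi_Q (emb u' d'))%qT) <->
          emb u d - emb u' d' \in face_group.
  by rewrite Quotient.idealrBE; split=> [/eqP|/eqP].
split=> [/face_groupP[b [e [b' [e' [f f' /eqP]]]]]|[b [e [b' [e' [f f' ub de]]]]]].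
  rewrite subr_eq addrAC -subr_eq opprK -!embD => /eqP/emb_inj[ub de].
  by exists b', e', b, e; split=> //; [rewrite ub addmC | rewrite de addnC].
apply/face_groupP; exists b', e', b, e; split=> //; apply/eqP.
by rewrite subr_eq addrAC eq_sym subr_eq -!embD addmC -ub addnC -de.
Qed.

(** The lattice points on the edges of the simplex [wt = L] suffice: they impose
    the relations of [edge_relations_ker] on the quotient by the face group, so
    that only the level [wt u - d L] survives there. *)
Lemma face_generates u d u' d' : (wt u + d' * L = wt u' + d * L)%N ->
  exists b e b' e', [/\ face b e, face b' e',
                        (u + b = u' + b')%MM & (d + e = d' + e')%N].
Proof.
move=> u_d; have [V [c [cD c0]]] := face_quotient.
have c00 : c 0%MM 0%N = 0.
  by apply: (addrI (c 0%MM 0%N)); rewrite addr0 -cD addm0.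
have c_face b e : face b e -> c b e = 0.
  move=> f; rewrite -c00; apply/c0; exists 0%MM, 0%N, b, e.
  by split; rewrite ?addm0 ?add0m ?addn0 //; apply: face_nil.
have cD0 v v' : c (v + v')%MM 0%N = c v 0%N + c v' 0%N by rewrite -cD.
have cMn v k : c (v *+ k)%MM 0%N = c v 0%N *+ k.
  elim: k => [|k IH]; first by rewrite mulm0n mulr0n.
  by rewrite mulmS cD0 IH mulrS.
have cT v k : c v k = c v 0%N + c 0%MM 1%N *+ k.
  elim: k => [|k IH]; first by rewrite mulr0n addr0.
  by rewrite -(addm0 v) -addn1 cD IH addm0 mulrnDr mulr1n addrA.
have vertex i : face (U_(i) *+ a i)%MM 1.
  by apply: face1; rewrite wtMn wtU lcm_wtK.
have cE v k : c v k = \sum_i c U_(i)%MM 0%N *+ v i + c 0%MM 1%N *+ k.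
  rewrite cT; congr (_ + _); rewrite {1}(multinomUE_id v).
  by elim/big_rec2: _ => [|i x y _ <-] //; rewrite cD0 cMn.
apply/c0; rewrite (cE u) (cE u').
apply: (edge_relations_ker a_gt0) u_d => [i|i k].
  apply/eqP; rewrite -addr_eq0 -cMn -[c 0%MM 1%N]mulr1n -cT.
  by rewrite c_face.
set g := gcdn _ _; set x := (a i %/ g)%N; set y := (a k %/ g)%N.
have g0 : (0 < g)%N by rewrite gcdn_gt0 a_gt0.
have xg : (x * g = a i)%N by rewrite divnK ?dvdn_gcdl.
have yg : (y * g = a k)%N by rewrite divnK ?dvdn_gcdr.
have le_x : (x <= a i)%N by apply: leq_div.
have wxy : (lcm_wt a i * x = lcm_wt a k * y)%N.
  by apply/eqP; rewrite -(eqn_pmul2r g0) -!mulnA xg yg !lcm_wtK.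
(* The lattice point of the edge next to the [i]-th vertex. *)
have edge : face (U_(i) *+ (a i - x) + U_(k) *+ y)%MM 1.
  apply: face1; rewrite wtD !wtMn !wtU -wxy -mulnDr subnK //.
  exact: lcm_wtK.
have := c_face _ _ edge; rewrite -(c_face _ _ (vertex i)).
have -> : (U_(i) *+ a i = U_(i) *+ (a i - x) + U_(i) *+ x)%MM.
  by apply/mnmP => j; rewrite mnmDE !mulmnE -mulnDr subnK.
by rewrite [c _ 1%N]cT [in X in _ = X -> _]cT !cD0 !cMn => /addIr/addrI.
Qed.

End Face.

(** * Exponents of the powers of the ideal *)

Section PowerExponents.
Variables (n : nat) (a : 'I_n -> nat).
Hypothesis a_gt0 : forall i, (0 < a i)%N.

Local Notation L := (lcm_exp a).
Local Notation wt := (wt (lcm_wt a)).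
Local Notation face := (face a).

(** The exponents of the monomials in the [d]-th power of the ideal spanned by
    the monomials of weight at least [L]. *)
Inductive power_exp : 'X_{1..n} -> nat -> Prop :=
| power_exp0 u : power_exp u 0
| power_expS v u d of (L <= wt v)%N & power_exp u d : power_exp (v + u)%MM d.+1.

Lemma power_exp_wt u d : power_exp u d -> (d * L <= wt u)%N.
Proof.
by elim=> [|v {}u {}d v_L _ IH] //; rewrite wtD mulSn leq_add.
Qed.

Lemma power_exp_addl v u d : power_exp u d -> power_exp (v + u)%MM d.
Proof.
by elim=> [{}u|v' {}u {}d v_L _ IH]; [left|rewrite addmA (addmC v) -addmA; right].
Qed.

Lemma power_expD u d u' d' :
  power_exp u d -> power_exp u' d' -> power_exp (u + u')%MM (d + d').
Proof.
move=> + u'_d'; elim=> [{}u|v {}u {}d v_L _ IH].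
  by rewrite add0n; apply: power_exp_addl.
by rewrite -addmA addSn; right.
Qed.

Lemma power_exp_pred u d : power_exp u d.+1 -> power_exp u d.
Proof.
move=> p; inversion p as [|v u' d' _ p' E1 E2]; exact: power_exp_addl.
Qed.

Lemma power_expW d u d' : (d' <= d)%N -> power_exp u d -> power_exp u d'.
Proof.
move=> /subnKC <-; elim: (d - d')%N => [|k IH]; first by rewrite addn0.
by rewrite addnS => /power_exp_pred.
Qed.

Lemma face_power_exp b e : face b e -> power_exp b e.
Proof. by elim=> [|v {}b {}e v_L _]; [left|right; rewrite ?v_L]. Qed.

(** Rounding [u] down to a multiple of the vertices loses less than [L] in each
    of the [n] coordinates. *)
Lemma wt_power_exp u d : ((d + n) * L <= wt u)%N -> power_exp u d.
Proof.
move=> le_u; pose q i := (u i %/ a i)%N.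
have q_le : (d <= \sum_i q i)%N.
  rewrite -(leq_pmul2r (lcm_exp_gt0 a_gt0)) -(leq_add2r (n * L)) -mulnDl.
  apply: leq_trans le_u _; rewrite big_distrl /=.
  have -> : (n * L = \sum_(i < n) L)%N by rewrite sum_nat_const card_ord.
  rewrite -big_split; apply: leq_sum => i _ /=.
  rewrite -{1 2}(lcm_wtK a i) {1}(divn_eq (u i) (a i)) -/(q i).
  by have := ltn_pmod (u i) (a_gt0 i); nia.
apply: power_expW q_le _.
have vertex i k : power_exp (U_(i) *+ (a i * k))%MM k.
  elim: k => [|k IH]; first by left.
  have -> : (U_(i) *+ (a i * k.+1) = U_(i) *+ a i + U_(i) *+ (a i * k))%MM.
    by apply/mnmP => j; rewrite mnmDE !mulmnE mulnS mulnDr.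
  by right; rewrite // wtMn wtU lcm_wtK.
have -> : u = ([multinom (u i %% a i)%N | i < n] +
               \sum_i U_(i) *+ (a i * q i))%MM.
  apply/mnmP => i; rewrite mnmDE mnmE mnm_sumE (bigD1 i) //= mulmnE mnm1E eqxx.
  rewrite big1 => [|j /negbTE ji]; last by rewrite mulmnE mnm1E ji mul0n.
  by rewrite mul1n addn0 addnC mulnC -divn_eq.
apply: power_exp_addl; elim/big_rec2: _ => [|i k v _]; first by left.
exact: power_expD.
Qed.

(** The values [wt v - d L] taken on the exponents [(v, d)] of the extended
    Rees algebra, whose degrees [d] may be negative. *)
Definition value (k : nat) : Prop := exists v d d',
  power_exp v d /\ (wt v + d' * L = d * L + k)%N.

Lemma valueDL k : value k -> value (k + L).
Proof.
move=> [v [d [d' [p e]]]]; exists v, d, d'.+1; split=> //.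
by rewrite mulSn addnCA e; ring.
Qed.

Lemma wt_value u d k : power_exp u d -> wt u = (d * L + k)%N -> value k.
Proof. by move=> p e; exists u, d, 0%N; rewrite addn0. Qed.

Lemma value_pred u d k :
  power_exp u d.+1 -> wt u = (d * L + k)%N -> exists2 k', value k' & k = (k' + L)%N.
Proof.
move=> p e; have := power_exp_wt p; rewrite e => le_d.
exists (k - L)%N; last by rewrite subnK //; move: le_d; rewrite mulSn; lia.
by apply: wt_value p _; rewrite e; move: le_d; rewrite mulSn; lia.
Qed.

(** The Apery set of the values with respect to [L]: the least value in each
    residue class.  Its elements are values of exponents of non-negative degree,
    because a negative degree leaves room to subtract [L]. *)
Lemma apery : exists mu : 'I_L -> nat, [/\ injective mu,
  forall r, exists u d, power_exp u d /\ wt u = (d * L + mu r)%N,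
  forall r k, mu r = (k + L)%N -> ~ value k &
  forall k, value k -> (exists r, mu r = k) \/
                       (exists2 k', value k' & k = (k' + L)%N)].
Proof.
have L0 := lcm_exp_gt0 a_gt0.
have /choice[mu muP] (r : 'I_L) : exists k,
    [/\ value k, (k %% L)%N = r &
        forall k', value k' -> (k' %% L)%N = r -> (k <= k')%N].
  have [u [d u_d]] := lcm_wt_surj a_gt0 (ltn_ord r).
  have ex : exists k, `[< value k /\ (k %% L)%N = r >].
    exists (d * L + r)%N; apply/asboolP; rewrite modnMDl modn_small //; split=> //.
    by apply: (@wt_value u 0%N); first left.
  case: (ex_minnP ex) => k /asboolP[k_val k_r] k_min; exists k; split=> // k' v r'.
  by apply: k_min; apply/asboolP.
have mu_min r k : mu r = (k + L)%N -> ~ value k.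
  move=> e k_val; have [_ mu_r /(_ k k_val)] := muP r.
  by rewrite -mu_r e modnDr => /(_ erefl); lia.
exists mu; split=> //.
- move=> r r' e; have [_ mu_r _] := muP r; have [_ mu_r' _] := muP r'.
  by apply/val_inj; rewrite /= -mu_r -mu_r' e.
- move=> r; have [[v [d [d' [p e]]]] _ _] := muP r.
  have le_d' : (d' <= d)%N.
    rewrite leqNgt; apply/negP => lt_d; apply: (@mu_min r (mu r - L)%N).
      by rewrite subnK //; have := power_exp_wt p; nia.
    exists v, d, d'.-1; split=> //; have := power_exp_wt p; nia.
  exists v, (d - d')%N; split; first by apply: power_expW p; apply: leq_subr.
  by move: e; rewrite -{1}(subnK le_d') mulnDl; lia.
move=> k k_val; pose r := Ordinal (ltn_pmod k L0).
have [mu_val mu_r /(_ k k_val erefl) le_mu] := muP r.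
have /dvdnP[t kt] : (L %| k - mu r)%N by rewrite -eqn_mod_dvd // mu_r.
case: t kt => [|t] kt; first by left; exists r; lia.
right; exists (mu r + t * L)%N; last by move: kt; rewrite mulSn; lia.
elim: {kt} t => [|t IH]; first by rewrite addn0.
by rewrite mulSn addnCA addnC; apply: valueDL.
Qed.

Lemma face_power_exp0 u d : wt u = (d * L)%N ->
  exists b e, face b e /\ power_exp (u + b)%MM (d + e).
Proof.
move=> u_d; have [|b [e [b' [e' [f f' ub de]]]]] :=
  @face_generates _ _ a_gt0 u d 0%MM 0.
  by rewrite wt0 mul0n addn0.
by exists b, e; rewrite ub de add0m add0n; split=> //; apply: face_power_exp.
Qed.

(** The exponents of one value [k] differ by the face group, so they belong
    together to the powers once multiplied by a suitable exponent of the face;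
    the shift by [L] in the weight pays for one more power. *)
Lemma face_power_exp_value u d k : value k -> wt u = (d * L + (k + L))%N ->
  exists b e, face b e /\ power_exp (u + b)%MM (d.+1 + e).
Proof.
move=> [v [d1 [d2 [p v_k]]]] u_k.
have [|b [e [b' [e' [f f' ub de]]]]] :=
  @face_generates _ _ a_gt0 u (d.+1 + d2) v d1; first by nia.
exists b, e; split=> //; rewrite ub.
apply: (@power_expW (d1 + e')); first by rewrite -de; lia.
exact: power_expD p (face_power_exp f').
Qed.

(** Sums of faces give common multipliers, as with common denominators. *)
Lemma common_face (I : eqType) (s : seq I) (u : I -> 'X_{1..n}) (d : I -> nat) :
  {in s, forall i, exists b e, face b e /\ power_exp (u i + b)%MM (d i + e)} ->
  exists b e, face b e /\ {in s, forall i, power_exp (u i + b)%MM (d i + e)}.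
Proof.
elim: s => [|i s IH] H; first by exists 0%MM, 0%N; split=> //; left.
have [|b [e [f Hs]]] := IH; first by move=> j js; apply: H; rewrite inE js orbT.
have [b' [e' [f' Hi]]] := H i (mem_head _ _).
exists (b + b')%MM, (e + e')%N; split; first exact: faceD.
move=> j; rewrite inE => /predU1P[->|js].
  rewrite [(b + b')%MM]addmC [(e + e')%N]addnC addmA addnA.
  exact: power_expD Hi (face_power_exp f).
by rewrite addmA addnA; apply: power_expD (Hs j js) (face_power_exp f').
Qed.

End PowerExponents.

(** * The powers of the integral closure *)

Section MonomialPowers.
Variables (K : idomainType) (n : nat) (a : 'I_n -> nat).
Hypothesis a_gt0 : forall i, (0 < a i)%N.

Local Notation L := (lcm_exp a).
Local Notation w := (lcm_wt a).
Local Notation wt := (wt w).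
Local Notation wge := (@wge K n w).
Local Notation wpart := (@wpart K n w).
Local Notation J :=
  (ideal_gen (range (fun i : 'I_n => 'X_i ^+ a i : {mpoly K[n]}))).
Local Notation I := (integral_closure J).

Lemma ideal_powW (A : comPzRingType) (S : set A) d d' :
  (d' <= d)%N -> ideal_pow S d `<=` ideal_pow S d'.
Proof.
move=> /subnKC <-; elim: (d - d')%N => [|k IH] x; first by rewrite addn0.
by rewrite addnS => /ideal_powS/IH.
Qed.

Lemma ideal_pow1 (A : comPzRingType) (S : set A) x : S x -> ideal_pow S 1 x.
Proof.
move=> Sx; apply: ideal_gen_sub; exists (fun=> x) => //.
by rewrite big_ord_recl big_ord0 mulr1.
Qed.

Lemma wge_ideal k : is_ideal (wge k).
Proof.
split=> [|x y|c x x_k]; [exact: wge0|exact: wgeD|].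
by rewrite -[k]add0n; apply: wgeM.
Qed.

Lemma ideal_pow_wge (S : set {mpoly K[n]}) k d :
  S `<=` wge k -> ideal_pow S d `<=` wge (d * k).
Proof.
move=> Sk; apply: ideal_gen_min; first exact: wge_ideal.
move=> _ [f Sf ->] /=; elim: d f Sf => [|d IH] f Sf; first by move=> i.
rewrite big_ord_recl mulSn; apply: wgeM; first exact: Sk.
by apply: IH => i; apply: Sf.
Qed.

(** An element of smaller order than [L] cannot satisfy an equation of
    integral dependence: its leading term in the equation is not cancelled. *)
Lemma integral_closure_wge : I `<=` wge L.
Proof.
have J_L : J `<=` wge L.
  apply: ideal_gen_min; first exact: wge_ideal.
  move=> _ [i _ <-] /=; rewrite mpolyXn; apply: wgeX.
  by rewrite wtMn wtU lcm_wtK.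
move=> x [m [c [m0 c_J eq_x]]].
have [//|/wge_exact[k [lt_kL x_k xk0]]] := pselect (wge L x); exfalso.
have := congr1 (wpart (k * m)) eq_x.
rewrite [RHS](@wge0 _ _ _ (k * m).+1) // wpartD wpart_exp // => /eqP.
apply/negP.
suff -> : wpart (k * m) (\sum_(1 <= i < m.+1) c i * x ^+ (m - i)) = 0.
  by rewrite addr0 expf_neq0.
suff : wge (k * m).+1 (\sum_(1 <= i < m.+1) c i * x ^+ (m - i)) by apply.
apply: wge_sum => i; rewrite mem_index_iota => i_m.
apply: (@wgeW _ _ _ (i * L + k * (m - i))); first by nia.
by apply: wgeM; [apply: ideal_pow_wge J_L _ (c_J i i_m)|apply: wgeXn].
Qed.

(** The [L]-th power of a monomial of weight at least [L] is a product of
    [wt u] of the given generators. *)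
Lemma integral_closureX u : (L <= wt u)%N -> I 'X_[u].
Proof.
move=> u_L; exists L, (fun i => if i == L then - 'X_[u] ^+ L else 0).
have vertex i k : ideal_pow J k 'X_[U_(i) *+ (a i * k)].
  elim: k => [|k IH].
    by rewrite muln0 mulm0n mpolyX0; apply: ideal_pow0.
  have -> : (U_(i) *+ (a i * k.+1) = U_(i) *+ a i + U_(i) *+ (a i * k))%MM.
    by apply/mnmP => j; rewrite mnmDE !mulmnE mulnS mulnDr.
  rewrite mpolyXD -add1n; apply: ideal_powM => //; apply: ideal_pow1.
  by apply: ideal_gen_sub; exists i => //; rewrite mpolyXn.
have XL : ideal_pow J L ('X_[u] ^+ L).
  apply: ideal_powW u_L _ _; rewrite mpolyXn.
  have -> : (u *+ L = \sum_i U_(i) *+ (a i * (w i * u i)))%MM.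
    apply/mnmP => i; rewrite mulmnE mnm_sumE (bigD1 i) //= mulmnE mnm1E eqxx.
    rewrite big1 => [|j /negbTE ji]; last by rewrite mulmnE mnm1E ji mul0n.
    by rewrite mul1n addn0 -(lcm_wtK a i); ring.
  rewrite /wt; elim/big_rec2: _ => [|i k v _ IH].
    by rewrite mpolyX0; apply: ideal_pow0.
  by rewrite mpolyXD; apply: ideal_powM.
split; first exact: lcm_exp_gt0.
  move=> i _; case: eqP => [->|_]; last by have [] := ideal_pow_is_ideal J i.
  exact: ideal_opp (ideal_pow_is_ideal J L) XL.
rewrite big_nat_recr /= ?lcm_exp_gt0 // eqxx subnn expr0 mulr1.
rewrite big_nat big1 ?add0r ?subrr // => i /andP[_ lt_iL].
by rewrite ltn_eqF // mul0r.
Qed.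

(** Every monomial occurring in a product of elements of the closure is a
    product of monomials of weight at least [L], since the factors have order at
    least [L]. *)
Lemma ideal_pow_closure d f :
  ideal_pow I d f <-> {in msupp f, forall u, power_exp a u d}.
Proof.
split.
  move: f; apply: ideal_gen_min.
    split=> [u|x y x_d y_d u|c x x_d u]; first by rewrite msupp0.
      by move/msuppD_le; rewrite mem_cat => /orP[/x_d|/y_d].
    by move/msuppM_le/allpairsP => [[v v'] /= [_ /x_d v'_d ->]]; apply: power_exp_addl.
  move=> _ [f If ->] /=; elim: d f If => [|d IH] f If u; first by left.
  rewrite big_ord_recl => /msuppM_le/allpairsP[[v v'] /= [v_f v'_f ->]].
  right; last by apply: IH v'_f => i; apply: If.
  by have /wgeP := integral_closure_wge (If ord0); apply.
move=> f_d; have [I0 ID IM] := ideal_pow_is_ideal I d.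
have X_d d' u : power_exp a u d' -> ideal_pow I d' 'X_[u].
  elim=> [v|v v' {}d' v_L _ IH]; last first.
    rewrite mpolyXD -add1n; apply: ideal_powM IH.
    apply: ideal_pow1.
    exact: integral_closureX.
  have [_ _ +] := ideal_pow_is_ideal I 0.
  by move=> /(_ 'X_[v] _ (@ideal_pow0 _ I)); rewrite mulr1.
rewrite [f]mpolyE; move: f_d; elim: (msupp f) => [|u s IH] s_d.
  by rewrite big_nil.
rewrite big_cons; apply: ID.
  rewrite -mul_mpolyC; apply: IM; apply: (X_d d u).
  exact: (s_d u (mem_head _ _)).
by apply: IH => v v_s; apply: s_d; rewrite inE v_s orbT.
Qed.

End MonomialPowers.

(** * Orders in the Rees algebra *)

Section ReesOrder.
Variables (K : idomainType) (n : nat) (w : 'I_n -> nat) (L : nat).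
Implicit Types (p q : {poly {mpoly K[n]}}) (u v : 'X_{1..n}).

(** The weighted order of [p] is at least [k], where [T] has weight [- L]. *)
Definition Tge k p : Prop := forall j, wge w (j * L + k) p`_j.

Definition lead k p : {poly {mpoly K[n]}} :=
  \poly_(j < size p) wpart w (j * L + k) p`_j.

Lemma coef_lead k p j : (lead k p)`_j = wpart w (j * L + k) p`_j.
Proof.
rewrite coef_poly; case: ltnP => // le_p.
by rewrite nth_default // [RHS](@wge0 _ _ _ (j * L + k).+1).
Qed.

Lemma TgeW k l p : (l <= k)%N -> Tge k p -> Tge l p.
Proof. by move=> le_lk p_k j; apply: wgeW (p_k j); rewrite leq_add2l. Qed.

Lemma TgeS k p : Tge k.+1 p <-> Tge k p /\ lead k p = 0.
Proof.
split=> [p_k|[p_k p0] j].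
  split; first exact: TgeW p_k.
  by apply/polyP => j; rewrite coef0 coef_lead p_k // addnS.
by rewrite addnS; apply: wgeS => //; rewrite -coef_lead p0 coef0.
Qed.

Lemma Tge0 k : Tge k 0.
Proof. by move=> j; rewrite coef0; apply: wge0. Qed.

Lemma TgeD k p q : Tge k p -> Tge k q -> Tge k (p + q).
Proof. by move=> p_k q_k j; rewrite coefD; apply: wgeD. Qed.

Lemma TgeM k l p q : Tge k p -> Tge l q -> Tge (k + l) (p * q).
Proof.
move=> p_k q_l j; rewrite coefM; apply: wge_sum => i _.
have le_ij : (i <= j)%N by rewrite -ltnS.
rewrite -{1}(subnKC le_ij) mulnDl addnACA; exact: wgeM.
Qed.

Lemma TgeXn k m p : Tge k p -> Tge (k * m) (p ^+ m).
Proof.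
move=> p_k; elim: m => [|m IHm]; last by rewrite exprS mulnS; apply: TgeM.
rewrite muln0 => j; rewrite expr0 coef1 addn0; case: eqP => [-> //|_].
exact: wge0.
Qed.

Lemma TgeN k p : Tge k p -> Tge k (- p).
Proof.
move=> p_k j; rewrite coefN -mulN1r -[(j * L + k)%N]add0n.
by apply: wgeM => // i.
Qed.

Lemma leadD k p q : lead k (p + q) = lead k p + lead k q.
Proof.
by apply/polyP => j; rewrite coefD !coef_lead coefD wpartD.
Qed.

Lemma leadB k p q : lead k (p - q) = lead k p - lead k q.
Proof. by apply: (addIr (lead k q)); rewrite -leadD !subrK. Qed.

Lemma lead_id k p : lead k (lead k p) = lead k p.
Proof. by apply/polyP => j; rewrite !coef_lead wpart_id. Qed.

Lemma Tge_lead k p : Tge k (lead k p).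
Proof. by move=> j; rewrite coef_lead; apply: wge_wpart. Qed.

(** The lowest term of a product of elements of given orders is the product of
    the lowest terms, so the order is a valuation. *)
Lemma leadM k l p q : Tge k p -> Tge l q ->
  lead (k + l) (p * q) = lead k p * lead l q.
Proof.
move=> p_k q_l; apply/polyP => j; rewrite coef_lead !coefM wpart_sum.
apply: eq_bigr => i _; have le_ij : (i <= j)%N by rewrite -ltnS.
by rewrite !coef_lead -{1}(subnKC le_ij) mulnDl addnACA wpartM.
Qed.

Lemma Tge_prime p q : Tge 0 p -> Tge 0 q -> Tge 1 (p * q) -> Tge 1 p \/ Tge 1 q.
Proof.
move=> p0 q0 /TgeS[_ /eqP]; rewrite -[0%N]addn0 leadM // mulf_eq0.
by case/orP => /eqP e; [left|right]; apply/TgeS.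
Qed.

Lemma msupp_neq0 p : p != 0 -> exists j u, u \in msupp p`_j.
Proof.
move=> p0; exists (size p).-1, (mlead (lead_coef p)).
by rewrite mlead_supp // lead_coef_eq0.
Qed.

Definition mono u m : {poly {mpoly K[n]}} := 'X_[u] *: 'X^m.

Lemma mono_neq0 u m : mono u m != 0.
Proof.
rewrite -lead_coef_eq0 lead_coefZ lead_coefXn mulr1.
by apply/eqP => /(congr1 (mcoeff u))/eqP; rewrite mcoeffX eqxx mcoeff0 oner_eq0.
Qed.

Lemma coef_monoM u m p j :
  (mono u m * p)`_j = if (j < m)%N then 0 else 'X_[u] * p`_(j - m).
Proof.
by rewrite -scalerAl coefZ coefXnM; case: ifP => // _; rewrite mulr0.
Qed.

Lemma msupp_monoM u m p j v : v \in msupp (mono u m * p)`_j ->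
  exists i v', [/\ v' \in msupp p`_i, j = (m + i)%N & v = (v' + u)%MM].
Proof.
rewrite coef_monoM; case: ltnP => [_|le_mj]; first by rewrite msupp0.
move/msuppM_le/allpairsP => [[v1 v2] /= []]; rewrite msuppX inE => /eqP -> v2_p ->.
by exists (j - m)%N, v2; split; rewrite ?subnKC // addmC.
Qed.

Lemma msupp_lead k p j u : u \in msupp (lead k p)`_j ->
  u \in msupp p`_j /\ wt w u = (j * L + k)%N.
Proof.
rewrite coef_lead !mcoeff_msupp mcoeff_wpart.
by case: (wt w u =P _) => // _; rewrite eqxx.
Qed.

Lemma lead_eq p : (forall j u, u \in msupp p`_j -> wt w u = (j * L)%N) ->
  lead 0 p = p.
Proof.
move=> p_hom; apply/polyP => j; rewrite coef_lead addn0; apply/mpolyP => u.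
rewrite mcoeff_wpart; have [/p_hom->|/memN_msupp_eq0->] := boolP (u \in msupp p`_j).
  by rewrite eqxx.
by rewrite mul0rn.
Qed.

Lemma lead_mono u m k : wt w u = (m * L + k)%N ->
  Tge k (mono u m) /\ lead k (mono u m) = mono u m.
Proof.
move=> u_k; split=> [j|].
  rewrite coefZ coefXn; case: eqP => [->|_]; last by rewrite mulr0; apply: wge0.
  by rewrite mulr1; apply: wgeX; rewrite u_k.
apply/polyP => j; rewrite coef_lead coefZ coefXn; case: eqP => [->|_].
  by rewrite mulr1 -u_k wpartX.
by rewrite mulr0 [LHS](@wge0 _ _ _ (j * L + k).+1).
Qed.

End ReesOrder.

(** * The associated graded ring *)

Section GradedRing.
Variables (K : idomainType) (n : nat) (a : 'I_n -> nat).
Hypothesis a_gt0 : forall i, (0 < a i)%N.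

Local Notation L := (lcm_exp a).
Local Notation w := (lcm_wt a).
Local Notation wt := (wt w).
Local Notation Tge := (@Tge K n w L).
Local Notation lead := (@lead K n w L).
Local Notation mono := (mono K).

Variable I : set {mpoly K[n]}.
Hypothesis ideal_powP : forall d f,
  ideal_pow I d f <-> {in msupp f, forall u, power_exp a u d}.

Implicit Types (p q r : rees I).

Definition rees_poly p : {poly {mpoly K[n]}} := val p.
Local Notation V := rees_poly.

Lemma rees_exp p j u : u \in msupp (V p)`_j -> power_exp a u j.
Proof. by have /ideal_powP := @rees_coef _ I p j; apply. Qed.

Lemma rees_mk (f : {poly {mpoly K[n]}}) :
  (forall j u, u \in msupp f`_j -> power_exp a u j) -> exists p, V p = f.
Proof.
move=> f_exp; have f_rees : f \in rees_pred I.
  by apply/reesP => j; apply/ideal_powP => u; apply: f_exp.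
by exists (Rees f_rees).
Qed.

Lemma rees_mono u d : power_exp a u d -> exists p, V p = mono u d.
Proof.
move=> u_d; apply: rees_mk => j v; rewrite /mono coefZ coefXn.
case: eqP => [->|_]; last by rewrite mulr0 msupp0.
by rewrite mulr1 msuppX inE => /eqP ->.
Qed.

Lemma rees_Tge0 p : Tge 0 (V p).
Proof.
by move=> j; rewrite addn0; apply/wgeP => u /rees_exp/power_exp_wt.
Qed.

Lemma gr_ker_exp p j u :
  p \in @gr_ker _ I -> u \in msupp (V p)`_j -> power_exp a u j.+1.
Proof. by move=> /gr_kerP/(_ j)/ideal_powP; apply. Qed.

Lemma gr_kerI p : (forall j u, u \in msupp (V p)`_j -> power_exp a u j.+1) ->
  p \in @gr_ker _ I.
Proof. by move=> H; apply/gr_kerP => j; apply/ideal_powP => u; apply: H. Qed.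

Lemma gr_ker_Tge p : p \in @gr_ker _ I -> Tge L (V p).
Proof.
move=> p_ker j; apply/wgeP => u /(gr_ker_exp p_ker)/power_exp_wt.
by rewrite mulSn addnC.
Qed.

Lemma Tge_gr_ker p : Tge (n.+1 * L) (V p) -> p \in @gr_ker _ I.
Proof.
move=> p_n; apply: gr_kerI => j u u_p; apply: (wt_power_exp a_gt0).
by have /wgeP/(_ u u_p) := p_n j; rewrite addSnnS mulnDl.
Qed.

Lemma gr_class0 : gr_class 0 = 0 :> gr I.
Proof.
by apply: (addrI (gr_class 0)); rewrite -gr_classD !addr0.
Qed.

Lemma gr_classB p q : gr_class (p - q) = gr_class p - gr_class q.
Proof. by apply: (addIr (gr_class q)); rewrite -gr_classD !subrK. Qed.

Lemma gr_classM p q : gr_class p * gr_class q = gr_class (p * q).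
Proof. exact: gr_mulE. Qed.

Lemma gr_classX p m : gr_class p ^+ m = gr_class (p ^+ m).
Proof.
elim: m => [|m IH]; first by rewrite !expr0.
by rewrite !exprS IH gr_classM.
Qed.

Lemma Vadd p q : V (p + q) = V p + V q. Proof. exact: rmorphD. Qed.
Lemma Vsub p q : V (p - q) = V p - V q. Proof. exact: rmorphB. Qed.
Lemma Vmul p q : V (p * q) = V p * V q. Proof. exact: rmorphM. Qed.
Lemma Vexp p m : V (p ^+ m) = V p ^+ m. Proof. exact: rmorphXn. Qed.

Definition pos_ideal : set (gr I) :=
  [set x | exists2 p, Tge 1 (V p) & x = gr_class p].

Lemma pos_idealP p : pos_ideal (gr_class p) <-> Tge 1 (V p).
Proof.
split=> [[q q1 /gr_eqP/gr_ker_Tge pq]|p1]; last by exists p.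
rewrite -[p](subrK q) Vadd; apply: TgeD => //.
by apply: TgeW pq; apply: lcm_exp_gt0.
Qed.

Lemma pos_ideal_prime : is_prime pos_ideal.
Proof.
split=> [|one_pos|].
- split=> [|_ _ [p p1 ->] [q q1 ->]|x _ [q q1 ->]].
  + by exists 0; [rewrite /rees_poly raddf0; apply: Tge0|rewrite gr_class0].
  + by exists (p + q); [rewrite Vadd; apply: TgeD|rewrite gr_classD].
  elim/gr_ind: x => p; exists (p * q); last by rewrite gr_classM.
  by rewrite Vmul -[1%N]add0n; apply: TgeM => //; apply: rees_Tge0.
- have /pos_idealP/(_ 0%N 0%N) H : pos_ideal (gr_class 1) := one_pos.
  have : wpart w 0 (V 1)`_0 != 0.
    rewrite /rees_poly rmorph1 coef1 -mpolyX0 -[X in wpart _ X](wt0 w) wpartX mpolyX0.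
    exact: oner_neq0.
  by rewrite H // eqxx.
elim/gr_ind=> p; elim/gr_ind=> q; rewrite gr_classM !pos_idealP Vmul.
by apply: Tge_prime; apply: rees_Tge0.
Qed.

Definition pos_prime : prime_ideal (gr I) := PrimeIdeal pos_ideal_prime.

(** Elements of positive order are nilpotent in the graded ring: a high power has
    order at least [(n + 1) L] and so is zero there. *)
Lemma pos_prime_min (Q : prime_ideal (gr I)) : pos_prime `<=` Q.
Proof.
move=> _ [p p1 ->]; have [[Q0 _ _] Q1 QM] := prime_setP Q.
have : prime_set Q (gr_class p ^+ (n.+1 * L)).
  rewrite gr_classX; suff -> : gr_class (p ^+ (n.+1 * L)) = 0 by [].
  rewrite -gr_class0; apply/gr_eqP; rewrite subr0; apply: Tge_gr_ker.
  by rewrite Vexp -{1}[(_ * _)%N]mul1n; apply: TgeXn.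
elim: (n.+1 * L)%N => [|m IH]; first by rewrite expr0.
by rewrite exprS => /QM[|/IH].
Qed.

(** * The local ring at the minimal prime *)

Local Notation loc := (localization pos_prime).

Lemma lead0P p : lead 0 (V p) <> 0 <-> ~ pos_ideal (gr_class p).
Proof.
split=> [p0 /pos_idealP/TgeS[]//|np p0]; apply: np; apply/pos_idealP/TgeS.
by split=> //; apply: rees_Tge0.
Qed.

Lemma denom_class (s : denom pos_prime) :
  exists2 r, denom_val s = gr_class r & lead 0 (V r) <> 0.
Proof.
case: s => x nx; exists (repr x); first by rewrite /gr_class reprK.
by apply/lead0P; rewrite /gr_class reprK.
Qed.

Lemma loc_frac_scale p s r (nr : ~ pos_ideal (gr_class r)) :
  loc_frac (gr_class p) s =
  loc_frac (gr_class (r * p)) (denomM (Denom (P := pos_prime) nr) s).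
Proof.
by apply/loc_fracP; exists (denom1 _) => /=; rewrite -gr_classM; ring.
Qed.

Definition level k : set loc :=
  [set x | exists2 p, Tge k (V p) & exists s, x = loc_frac (gr_class p) s].

Lemma level_ideal k : is_ideal (level k).
Proof.
split=> [|_ _ [p p_k [s ->]] [q q_k [t ->]]|x _ [q q_k [t ->]]].
- exists 0; first by rewrite /rees_poly raddf0; apply: Tge0.
  by exists (denom1 _); rewrite gr_class0.
- have [s' sE _] := denom_class s; have [t' tE _] := denom_class t.
  exists (p * t' + q * s').
    rewrite Vadd !Vmul -[k]addn0; apply: TgeD; apply: TgeM => //; exact: rees_Tge0.
  exists (denomM s t); apply: etrans (loc_addE _ _ _ _) _.
  by rewrite sE tE !gr_classM gr_classD.
elim/loc_ind: x => x s; elim/gr_ind: x => p; exists (p * q).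
  by rewrite Vmul -[k]add0n; apply: TgeM => //; apply: rees_Tge0.
exists (denomM s t); apply: etrans (loc_mulE _ _ _ _) _.
by rewrite gr_classM.
Qed.

Lemma level_top : level 0 = setT.
Proof.
apply/seteqP; split=> // x _; elim/loc_ind: x => x s; elim/gr_ind: x => p.
by exists p; [apply: rees_Tge0 | exists s].
Qed.

Lemma level_bot : level (n.+1 * L) `<=` [set 0].
Proof.
move=> _ [p p_n [s ->]] /=; have -> : gr_class p = 0.
  by rewrite -gr_class0; apply/gr_eqP; rewrite subr0; apply: Tge_gr_ker.
change (loc_frac 0 s = loc_frac 0 (denom1 pos_prime)).
by apply/loc_fracP; exists (denom1 _); rewrite !mul0r.
Qed.

Lemma level_dec k : level k.+1 `<=` level k.
Proof.
by move=> x [p p_k [s ->]]; exists p; [apply: TgeW p_k | exists s].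
Qed.

(** A polynomial has finitely many exponents, so one face exponent serves for
    all of them. *)
Lemma common_face_poly (f : {poly {mpoly K[n]}}) c m :
  (forall j u, u \in msupp f`_j ->
     exists b e, face a b e /\ power_exp a (u + c + b)%MM (j + m + e)) ->
  exists b e, face a b e /\ forall j u, u \in msupp f`_j ->
     power_exp a (u + c + b)%MM (j + m + e).
Proof.
move=> H; pose s := [seq (u, j) | j <- iota 0 (size f), u <- msupp f`_j].
have [|b [e [fbe Hs]]] := @common_face _ a _ s
  (fun i => (i.1 + c)%MM) (fun i => (i.2 + m)%N).
  by move=> _ /allpairsPdep[j [u [_ u_f ->]]]; apply: H.
exists b, e; split=> // j u u_f; apply: (Hs (u, j)).
apply/allpairsPdep; exists j, u; split=> //; rewrite mem_iota /=.
by rewrite ltnNge; apply: contraL u_f => le_f; rewrite nth_default // msupp0.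
Qed.

Lemma face_rees b e : face a b e ->
  exists r, [/\ V r = mono b e, lead 0 (V r) = V r & ~ pos_ideal (gr_class r)].
Proof.
move=> f; have [r rE] := rees_mono (face_power_exp f); exists r.
have b_e : wt b = (e * L + 0)%N by rewrite addn0; apply: wt_face.
have [_ r_lead] := lead_mono K b_e.
split; rewrite ?rE //; apply/lead0P; rewrite rE r_lead.
by apply/eqP/mono_neq0.
Qed.

Section Apery.
Variable mu : 'I_L -> nat.
Hypothesis mu_value : forall t, exists u d,
  power_exp a u d /\ wt u = (d * L + mu t)%N.
Hypothesis mu_min : forall t k, mu t = (k + L)%N -> ~ value a k.
Hypothesis mu_gen : forall k, value a k ->
  (exists t, mu t = k) \/ (exists2 k', value a k' & k = (k' + L)%N).

(** If [k] is not in the Apery set, then every exponent of value [k] in the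
    Rees algebra becomes, after multiplication by an exponent of the face, an
    exponent of the kernel of the projection to the graded ring. *)
Lemma level_flat k : (forall t, mu t <> k) -> level k `<=` level k.+1.
Proof.
move=> k_mu _ [p p_k [s ->]].
have [|b [e [fbe Hbe]]] := @common_face_poly (lead k (V p)) 0%MM 1%N.
  move=> j u /msupp_lead[u_p u_k]; rewrite addm0 addn1.
  have /mu_gen[[r rk]|[k' k'_val kk']] := wt_value (rees_exp u_p) u_k.
    by have := k_mu r.
  by apply: face_power_exp_value a_gt0 _ _ _ k'_val _; rewrite u_k kk'.
have [t [tE t_lead nt]] := face_rees fbe.
(* [g] is the lowest term of [t p]; subtracting it raises the order and does not
   change the class in the graded ring. *)
have [g gE] : exists g, V g = V t * lead k (V p).
  apply: rees_mk => j u; rewrite tE.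
  case/msupp_monoM=> i [v [v_p -> ->]]; have := Hbe i v v_p.
  by rewrite addm0 addn1 addSn addnC => /power_exp_pred.
have g_ker : g \in @gr_ker _ I.
  apply: gr_kerI => j u; rewrite gE tE.
  case/msupp_monoM=> i [v [v_p -> ->]]; have := Hbe i v v_p.
  by rewrite addm0 addn1 addSn addnC.
rewrite (loc_frac_scale p s nt); exists (t * p - g); last first.
  eexists; congr loc_frac; apply/gr_eqP.
  by rewrite opprB addrC subrK.
have t0 : Tge 0 (V t) by apply: rees_Tge0.
have p'_k : Tge k (V p - lead k (V p)).
  by apply: TgeD => //; apply: TgeN; apply: Tge_lead.
apply/TgeS; rewrite Vsub Vmul gE -mulrBr -[k]add0n; split; first exact: TgeM.
by rewrite leadM // leadB lead_id subrr mulr0.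
Qed.

(** A monomial of order [mu t] stays outside the next level: otherwise some
    element of the kernel of the projection to the graded ring has order exactly
    [mu t], and its lowest term has exponents of value [mu t - L], contradicting
    the minimality of [mu t]. *)
Lemma level_jump t : exists2 x, level (mu t) x & ~ level (mu t).+1 x.
Proof.
have [u [d [u_d u_k]]] := mu_value t; have [p pE] := rees_mono u_d.
have [p_k p_lead] := lead_mono K u_k; rewrite -pE in p_k p_lead.
exists (loc_frac (gr_class p) (denom1 _)).
  by exists p => //; exists (denom1 _).
move=> [p' p'_k [s /loc_fracP[v]]]; have /TgeS[p'_k' p'0] := p'_k.
have [s' -> s0] := denom_class s; have [v' -> v0] := denom_class v.
rewrite /= mulr1 (gr_classM p s') !gr_classM => /gr_eqP g_ker.
have : lead (mu t) (V (v' * (p * s') - v' * p')) != 0.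
  have v'0 := rees_Tge0 v'; have s'0 := rees_Tge0 s'.
  have e1 := leadM v'0 (TgeM p_k s'0); have e2 := leadM v'0 p'_k'.
  rewrite (leadM p_k s'0) !addn0 add0n in e1; rewrite add0n in e2.
  rewrite Vsub !Vmul leadB e1 e2 p'0 mulr0 subr0.
  rewrite mulf_neq0 ?mulf_neq0 //; try exact/eqP.
  by rewrite p_lead pE mono_neq0.
move/msupp_neq0=> [j [u' /msupp_lead[u'_g u'_k]]].
have [k k_val tk] := value_pred (gr_ker_exp g_ker u'_g) u'_k.
exact: mu_min tk k_val.
Qed.

(** A monomial of order [- k] makes the lowest terms of two elements of order
    [k] into elements of order [0], which cross-multiply these lowest terms to
    the same product. *)
Lemma level_simple k x y : level k x -> level k y -> ~ level k.+1 y ->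
  exists c, level k.+1 (x - c * y).
Proof.
move=> [p p_k [s ->]] [p' p'_k [s' ->]] ny.
have p'0 : lead k (V p') != 0.
  by apply/eqP => p'0; apply: ny; exists p'; [apply/TgeS|exists s'].
have [c [m cm]] := lcm_wt_oppk a_gt0 k.
(* [x^c T^m] has order [- k]. *)
have clear (f : {poly {mpoly K[n]}}) : exists b e, face a b e /\
    forall j u, u \in msupp (lead k f)`_j ->
      power_exp a (u + c + b)%MM (j + m + e).
  apply: common_face_poly => j u /msupp_lead[_ u_k].
  by apply: face_power_exp0; rewrite // wtD u_k -addnA [(k + _)%N]addnC cm mulnDl.
have [b [e [fb Hb]]] := clear (V p); have [b' [e' [fb' Hb']]] := clear (V p').
have rees_z f d h d' h' : (forall j u, u \in msupp (lead k f)`_j ->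
      power_exp a (u + c + d)%MM (j + m + h)) -> face a d' h' ->
    exists r, V r = mono (c + d + d')%MM (m + h + h') * lead k f.
  move=> Hd fd'; apply: rees_mk => j u /msupp_monoM[i [v [v_f -> ->]]].
  have := power_expD (Hd i v v_f) (face_power_exp fd').
  by rewrite !addmA -!addnA [(i + _)%N]addnC -!addnA.
pose z := mono (c + b + b')%MM (m + e + e').
have [q qE] : exists q, V q = z * lead k (V p) by apply: rees_z.
have [q' q'E] : exists q', V q' = z * lead k (V p').
  have [q' e1] := rees_z _ _ _ _ _ Hb' fb; exists q'; rewrite e1.
  congr (mono _ _ * _).
    by rewrite -!addmA [(b + _)%MM]addmC.
  by rewrite -!addnA [(e + _)%N]addnC.
have lead_q f : lead 0 (z * lead k f) = z * lead k f.
  apply: lead_eq => j u /msupp_monoM[i [v [/msupp_lead[_ v_k] -> ->]]].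
  rewrite !wtD v_k (wt_face fb) (wt_face fb') !mulnDl -cm.
  by ring.
have nq' : ~ pos_ideal (gr_class q').
  apply/lead0P; rewrite q'E lead_q; apply/eqP.
  by rewrite mulf_neq0 // mono_neq0.
have pq : Tge k.+1 (V (q' * p - q * p')).
  have q0 := rees_Tge0 q; have q'0 := rees_Tge0 q'.
  rewrite Vsub !Vmul -[k]add0n; apply/TgeS; split.
    by apply: TgeD; [|apply: TgeN]; apply: TgeM.
  rewrite leadB !leadM // q'E qE !lead_q.
  by rewrite mulrAC subrr.
have [r rE _] := denom_class s; have [r' r'E _] := denom_class s'.
pose D := Denom (P := pos_prime) nq'.
exists (loc_frac (gr_class q * denom_val s') (denomM D s)).
exists ((q' * p - q * p') * (r * r')).
  by rewrite Vmul -[k.+1]addn0; apply: TgeM => //; apply: rees_Tge0.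
exists (denomM s (denomM (denomM D s) s')).
transitivity (loc_add (loc_frac (gr_class p) s)
  (loc_opp (loc_mul (loc_frac (gr_class q * denom_val s') (denomM D s))
                    (loc_frac (gr_class p') s')))) => //.
rewrite loc_mulE loc_oppE loc_addE; congr loc_frac.
by rewrite /= -!gr_classM gr_classB -!gr_classM rE r'E; ring.
Qed.

End Apery.

(** The ideal enters only through the monomials in its powers. *)
Lemma nu_monomial (R : realType) : nu R I = constructive_ereal.EFin L%:R.
Proof.
have [mu [mu_inj mu_value mu_min mu_gen]] := apery a_gt0.
rewrite (nu_unique_minimal _ pos_prime_min).
apply: (@ring_length_filtration loc L (n.+1 * L) level mu) => //.
- exact: level_ideal.
- exact: level_top.
- exact: level_bot.
- exact: level_dec.
- exact: level_flat mu_gen.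
- exact: level_jump mu_value mu_min.
- by move=> t; apply: level_simple.
Qed.

End GradedRing.

Unset Implicit Arguments.

Theorem corollary5p13 (R : realType) (n : nat) (a : 'I_n -> nat)
    (a_gt0 : forall i : 'I_n, (0 < a i)%N) :
  let J : set {mpoly R[i][n]} :=
    ideal_gen (range (fun i : 'I_n => 'X_i ^+ a i)) in
  nu R (integral_closure J) =
    constructive_ereal.EFin (\big[lcmn/1%N]_(i < n) a i)%:R.
Proof.
exact: (nu_monomial a_gt0 (ideal_pow_closure (K := R[i]) a_gt0)).
Qed.
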